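(* In the setting below (piecewise constant successive sleep modes (As3), finite $P_{\mathrm{max}}$), fix a target rate $R$ with $0<R\le R_{\mathrm{max}}$ and let $P^\star_{\mathrm{cons}}(N)$ be the minimum value of Problem (P) for frame length $N$ (other parameters fixed). For each feasible sleep mode $s\in\mathcal S_R$ define $$N_{\mathrm{a},s}=\mathrm{round}\!\left(\min\!\left(NR/\tilde R_s,\,N^+_{\mathrm{a},s}\right)\right),\qquad p_{n,s}=\begin{cases}(2^{RN/N_{\mathrm{a},s}}-1)\sigma^2,& n=0,\dots,N_{\mathrm{a},s}-1,\\ 0,&\text{otherwise,}\end{cases}$$ $$P_{\mathrm{cons},s}(N)=\frac{N_{\mathrm{a},s}}{N}\left(P_0+\gamma\sigma^{2\alpha}\left(2^{RN/N_{\mathrm{a},s}}-1\right)^{\alpha}\right)+\frac{E_{\mathrm{sleep}}((N-N_{\mathrm{a},s})T)}{NT}.$$ Then, as $N\to\infty$, $P^\star_{\mathrm{cons}}(N)=\min_{s\in\mathcal S_R}P_{\mathrm{cons},s}(N)+O(1/N)$; i.e. choosing the feasible mode $s$ with minimal $P_{\mathrm{cons},s}$ and the corresponding allocation is asymptotically optimal.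
   Context: Setting: fix $T>0$, $\sigma^2>0$, $P_{\mathrm{max}}\in(0,\infty)$, $\alpha\in(0,1]$, $\gamma>0$, $P_0\ge0$. (As3): there are sleep modes $s=0,1,\dots,S$ with start times $0=T_0\le T_1<\dots<T_S$, $T_{S+1}=+\infty$, and powers $P_0\ge P_1\ge\dots\ge P_S\ge0$; the sleep power is $P_{\mathrm{sleep}}(t)=P_s$ for $T_s<t\le T_{s+1}$, and $E_{\mathrm{sleep}}(t)=\int_0^tP_{\mathrm{sleep}}(t')dt'=\sum_{s'=0}^{s-1}P_{s'}(T_{s'+1}-T_{s'})+(t-T_s)P_s$ for $T_s<t\le T_{s+1}$ (and $E_{\mathrm{sleep}}(0)=0$). For an integer $N\ge1$, an allocation is $N_{\mathrm{a}}\in\{0,\dots,N\}$ with powers $p_0,\dots,p_{N_{\mathrm{a}}-1}\in[0,P_{\mathrm{max}}]$ ($p_n=0$ for $n\ge N_{\mathrm{a}}$); its consumed power is $P_{\mathrm{cons}}=\frac{N_{\mathrm{a}}}{N}P_0+\frac{\gamma}{N}\sum_{n=0}^{N_{\mathrm{a}}-1}p_n^{\alpha}+\frac{E_{\mathrm{sleep}}((N-N_{\mathrm{a}})T)}{NT}$. Problem (P): minimize $P_{\mathrm{cons}}$ subject to $\frac1N\sum_{n=0}^{N_{\mathrm{a}}-1}\log_2(1+p_n/\sigma^2)=R$. Definitions: $R_{\mathrm{max}}=\log_2(1+P_{\mathrm{max}}/\sigma^2)$; $N^+_{\mathrm{a},s}=N-\lfloor T_s/T\rfloor$ (largest number of active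 slots compatible with entering mode $s$); $\mathcal S_R=\{s\in\{0,\dots,S\}: NR/R_{\mathrm{max}}\le N^+_{\mathrm{a},s}\}$ (feasible sleep modes); $R_{\mathrm{a}}(s)$ is a minimizer over $x>0$ of $\frac{P_0-P_s+\gamma\sigma^{2\alpha}(2^x-1)^{\alpha}}{x}$ (with $R_{\mathrm{a}}(s)=0$ if $P_0=P_s,\alpha=1$); $\tilde R_s=\min(R_{\mathrm{a}}(s),R_{\mathrm{max}})$. $\mathrm{round}(\cdot)$ is rounding to the nearest integer. *)

(* Defs.v *)
From mathcomp Require Import all_boot all_order all_algebra.
From mathcomp Require Import all_classical all_reals all_analysis.
Set Implicit Arguments. Unset Strict Implicit. Unset Printing Implicit Defensive.
Import Order.TTheory GRing.Theory Num.Theory.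
Local Open Scope ring_scope.
Local Open Scope classical_set_scope.

Definition log2 {R : realType} (x : R) : R := ln x / ln 2.

(* R_max = log2(1 + P_max / sigma^2);  sigma2 stands for sigma^2 *)
Definition Rmax {R : realType} (sigma2 Pmax : R) : R := log2 (1 + Pmax / sigma2).

(* E_sleep(t) = int_0^t P_sleep for the piecewise-constant sleep power with
   modes 0..S, start times Ts 0 = 0 <= Ts 1 < ... < Ts S, T_{S+1} = +oo,
   powers Ps 0 >= ... >= Ps S: sum over modes of (power) * (length of
   (T_s, T_{s+1}] inside (0, t]).  For T_s < t <= T_{s+1} this is exactly
   sum_{s'<s} P_{s'}(T_{s'+1}-T_{s'}) + (t - T_s) P_s, and E_sleep 0 = 0. *)
Definition Esleep {R : realType} (S : nat) (Ts Ps : nat -> R) (t : R) : R :=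
  \sum_(s < S) Ps s * Num.max 0 (Num.min t (Ts s.+1) - Ts s)
  + Ps S * Num.max 0 (t - Ts S).

Definition Pcons {R : realType} (N : nat) (T gamma alpha : R) (S : nat)
    (Ts Ps : nat -> R) (Na : nat) (p : nat -> R) : R :=
  Na%:R / N%:R * Ps 0 + gamma / N%:R * \sum_(n < Na) p n `^ alpha
  + Esleep S Ts Ps ((N - Na)%:R * T) / (N%:R * T).

Definition feasible {R : realType} (N : nat) (sigma2 Pmax rate : R)
    (Na : nat) (p : nat -> R) : Prop :=
  [/\ (Na <= N)%N,
      (forall n, (n < Na)%N -> 0 <= p n <= Pmax) &
      1 / N%:R * \sum_(n < Na) log2 (1 + p n / sigma2) = rate].

(* optimal value P*_cons(N) of Problem (P) (infimum over feasible allocations;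
   it is attained) *)
Definition Pstar {R : realType} (N : nat) (T sigma2 Pmax gamma alpha : R)
    (S : nat) (Ts Ps : nat -> R) (rate : R) : R :=
  inf [set x | exists Na p, feasible N sigma2 Pmax rate Na p /\
                            x = Pcons N T gamma alpha S Ts Ps Na p].

Definition ra_obj {R : realType} (P0 Pss gamma alpha sigma2 x : R) : R :=
  (P0 - Pss + gamma * sigma2 `^ alpha * (2 `^ x - 1) `^ alpha) / x.

Definition is_Ra {R : realType} (P0 Pss gamma alpha sigma2 r : R) : Prop :=
  if (P0 == Pss) && (alpha == 1) then r = 0
  else 0 < r /\ forall x, 0 < x ->
      ra_obj P0 Pss gamma alpha sigma2 r <= ra_obj P0 Pss gamma alpha sigma2 x.

(* N^+_{a,s} = N - floor(T_s / T) (T_s >= 0, so floor = truncn) *)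
Definition Nplus {R : realType} (N : nat) (T : R) (Ts : nat -> R) (s : nat) : nat :=
  (N - Num.truncn (Ts s / T))%N.

Definition inSR {R : realType} (N : nat) (T sigma2 Pmax rate : R)
    (Ts : nat -> R) (s : nat) : bool :=
  N%:R * rate / Rmax sigma2 Pmax <= (Nplus N T Ts s)%:R.

(* rounding to the nearest integer (halves rounded up), for x >= 0 *)
Definition round {R : realType} (x : R) : nat := Num.truncn (x + 2^-1).

Definition Rtil {R : realType} (sigma2 Pmax : R) (Ra : nat -> R) (s : nat) : R :=
  Num.min (Ra s) (Rmax sigma2 Pmax).

(* N_{a,s} = round(min(N R / tilde R_s, N^+_{a,s})), with N R / 0 = +oo *)
Definition Nas {R : realType} (N : nat) (T sigma2 Pmax rate : R)
    (Ts Ra : nat -> R) (s : nat) : nat :=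
  if Rtil sigma2 Pmax Ra s == 0 then Nplus N T Ts s
  else round (Num.min (N%:R * rate / Rtil sigma2 Pmax Ra s) (Nplus N T Ts s)%:R).

Definition Pcons_s {R : realType} (N : nat) (T sigma2 Pmax gamma alpha : R)
    (S : nat) (Ts Ps Ra : nat -> R) (rate : R) (s : nat) : R :=
  let na := Nas N T sigma2 Pmax rate Ts Ra s in
  na%:R / N%:R * (Ps 0 + gamma * sigma2 `^ alpha
                          * (2 `^ (rate * N%:R / na%:R) - 1) `^ alpha)
  + Esleep S Ts Ps ((N - na)%:R * T) / (N%:R * T).

(* min_{s in S_R} P_{cons,s}(N); mode 0 always lies in S_R (T_0 = 0, R <= R_max),
   so it is used as the seed of the iterated minimum *)
Definition Pmin {R : realType} (N : nat) (T sigma2 Pmax gamma alpha : R)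
    (S : nat) (Ts Ps Ra : nat -> R) (rate : R) : R :=
  \big[Num.min/Pcons_s N T sigma2 Pmax gamma alpha S Ts Ps Ra rate 0%N]_(s < S.+1
      | inSR N T sigma2 Pmax rate Ts s)
     Pcons_s N T sigma2 Pmax gamma alpha S Ts Ps Ra rate s.

(* Main.v *)
Require Import Defs.
From mathcomp Require Import all_boot all_order all_algebra.
From mathcomp Require Import all_classical all_reals all_analysis.
From mathcomp Require Import ring lra.
Import Order.TTheory GRing.Theory Num.Theory.
Local Open Scope ring_scope.

(* Write [x_n] for the rate of slot [n], so that an active slot costs
   [P_0 + c (2^x_n - 1)^alpha].  Since the powers decrease, sleeping for a time
   [t] costs [P_S t + O(1)], so up to [O(1/N)] only the deepest mode [S] matters
   and [P_cons] is [P_S + (1/N) sum_n F(x_n)] over the active slots, where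
   [F(x) = P_0 - P_S + c (2^x - 1)^alpha].  With [M = max(R, R~_S)], the line
   that supports [F] on [0, R_max] and takes the value [R F(M) / M] at [R] (the
   chord from the origin to [M] if [R < M], the tangent at [R] otherwise) has a
   nonpositive value at 0; summing it over at most [N] slots bounds every
   allocation below by [V = P_S + R F(M) / M].  Conversely, a uniform allocation
   over [N R / M + O(1)] slots costs [V + O(1/N)], and the slot number prescribed
   for mode [S] is of this form.  When [R = R_max] mode [S] may be infeasible,
   but then [M = R] and mode 0 costs [V + O(1/N)] as well.

   [F] is concave and then convex; all that is used of its shape is that [F'] is
   quasi-convex. *)

(** * Cost of one active slot as a function of its rate *)

Definition slot_cost {R : realType} (a c al x : R) : R :=
  a + c * (2 `^ x - 1) `^ al.

Definition dslot_cost {R : realType} (c al x : R) : R :=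
  c * (al * (2 `^ x - 1) `^ (al - 1) * (2 `^ x * ln 2)).

Lemma pow2E (R : realType) (x : R) : 2 `^ x = expR (x * ln 2).
Proof. by rewrite /powR pnatr_eq0. Qed.

Lemma ln2_gt0 (R : realType) : 0 < ln (2 : R).
Proof. by rewrite ln_gt0 // ltr1n. Qed.

Lemma ler_pow2 (R : realType) (x y : R) : x <= y -> 2 `^ x <= 2 `^ y.
Proof. by move=> xy; rewrite ler_powR // ler1n. Qed.

Lemma pow2B1_ge0 (R : realType) (x : R) : 0 <= x -> 0 <= 2 `^ x - 1.
Proof. by move=> x0; rewrite subr_ge0; have := ler_pow2 _ _ _ x0; rewrite powRr0. Qed.

Lemma pow2B1_gt0 (R : realType) (x : R) : 0 < x -> 0 < 2 `^ x - 1.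
Proof.
by move=> x0; rewrite subr_gt0 pow2E -[ltLHS]expR0 ltr_expR mulr_gt0 // ln2_gt0.
Qed.

Lemma slot_cost_ge0 (R : realType) (a c al x : R) :
  0 <= a -> 0 <= c -> 0 <= slot_cost a c al x.
Proof. by move=> a0 c0; rewrite addr_ge0 // mulr_ge0 // powR_ge0. Qed.

Lemma ler_slot_cost (R : realType) (a c al x y : R) :
  0 <= c -> 0 <= al -> 0 <= x -> x <= y ->
  slot_cost a c al x <= slot_cost a c al y.
Proof.
move=> c0 al0 x0 xy; rewrite lerD2l ler_wpM2l // ge0_ler_powR //.
- by rewrite nnegrE pow2B1_ge0.
- by rewrite nnegrE pow2B1_ge0 // (le_trans x0).
- by rewrite lerD2r ler_pow2.
Qed.

(** * Quasi-convexity of the derivative of the slot cost *)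

(** Restricted to positive arguments because the slot cost need not be differentiable at 0 when
    [alpha < 1]. *)
Definition pos_derivative {R : realType} (f df : R -> R) : Prop :=
  forall x : R, 0 < x -> is_derive x 1 f (df x).

Definition pos_quasiconvex {R : realType} (g : R -> R) : Prop :=
  forall x y z, 0 < x -> x < y -> y < z -> g y <= g x \/ g y <= g z.

Lemma pos_derivative_MVT (R : realType) (f df : R -> R) (x y : R) :
  pos_derivative f df -> 0 < x -> x < y ->
  exists2 z, x < z < y & f y - f x = df z * (y - x).
Proof.
move=> fdf x0 xy; have [t||z zxy E] := @MVT R f df x y xy.
- by rewrite in_itv /= => /andP[xt _]; exact/fdf/(lt_trans x0).
- apply: derivable_within_continuous => z; rewrite in_itv /= => /andP[xz _].
  by have [] := fdf z (lt_le_trans x0 xz).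
- by exists z => //; rewrite in_itv in zxy.
Qed.

Lemma slot_cost_derivative (R : realType) (a c al : R) :
  pos_derivative (slot_cost a c al) (dslot_cost c al).
Proof.
move=> x x0.
have d2 : is_derive x 1 (fun t : R => 2 `^ t - 1) (2 `^ x * ln 2).
  rewrite (_ : (fun t => _) = (fun t : R => expR (t * ln 2) - 1)); last first.
    by apply/funext => t; rewrite pow2E.
  rewrite pow2E.
  have dl : is_derive x 1 (fun t : R => t * ln 2) (ln 2).
    by apply: is_derive_eq; rewrite scaler0 add0r scaler1.
  have de := @is_derive1_comp R expR (fun t => t * ln 2) x _ _
    (is_derive_expR (x * ln 2)) dl.
  have := is_deriveB de (is_derive_cst (1 : R) x 1).
  by rewrite subr0.
have dp : is_derive (2 `^ x - 1) 1 (fun u : R => u `^ al)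
    (al * (2 `^ x - 1) `^ (al - 1)).
  exact/is_derive1_powR/pow2B1_gt0.
have dc := @is_derive1_comp R (fun u => u `^ al) (fun t => 2 `^ t - 1) x _ _
  dp d2.
have := is_deriveD (is_derive_cst a x 1) (is_deriveZ c dc).
by rewrite add0r.
Qed.

(* In the variable [ln u] the function is a sum of two exponentials, hence
   convex; its slope at [v] decides which alternative holds. *)
Lemma powR_mul1D_quasiconvex (R : realType) (al u v w : R) :
  0 < al <= 1 -> 0 < u -> u < v -> v < w ->
  v `^ (al - 1) * (1 + v) <= u `^ (al - 1) * (1 + u) \/
  v `^ (al - 1) * (1 + v) <= w `^ (al - 1) * (1 + w).
Proof.
move=> /andP[al0 al1] u0 uv vw.
have v0 : 0 < v by apply: lt_trans uv.
have w0 : 0 < w by apply: lt_trans vw.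
have E (t : R) : 0 < t ->
    t `^ (al - 1) * (1 + t) = expR ((al - 1) * ln t) + expR (al * ln t).
  move=> t0; rewrite mulrDr mulr1 {1 2}/powR gt_eqF // -{3}(lnK t0) -expRD.
  by congr (_ + expR _); ring.
rewrite !E //.
have tangent (b s t : R) :
    expR (b * t) * (1 + b * (s - t)) <= expR (b * s).
  have -> : b * s = b * t + b * (s - t) by ring.
  by rewrite expRD ler_wpM2l ?expR_ge0 // expR_ge1Dx.
have uv' : ln u <= ln v by rewrite ler_ln // ltW.
have vw' : ln v <= ln w by rewrite ler_ln // ltW.
have Hu1 := tangent (al - 1) (ln u) (ln v).
have Hu2 := tangent al (ln u) (ln v).
have Hw1 := tangent (al - 1) (ln w) (ln v).
have Hw2 := tangent al (ln w) (ln v).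
set e1 := expR ((al - 1) * ln v) in Hu1 Hw1 *.
set e2 := expR (al * ln v) in Hu2 Hw2 *.
have [h|/ltW h] := leP 0 ((al - 1) * e1 + al * e2).
- right; have := mulr_ge0 h (_ : 0 <= ln w - ln v); rewrite subr_ge0 => /(_ vw').
  nra.
- left; have := mulr_le0 h (_ : ln u - ln v <= 0); rewrite subr_le0 => /(_ uv').
  nra.
Qed.

(** With [u = 2 ^ x - 1], an increasing change of variable, the derivative is a nonnegative constant
    times [u ^ (al - 1) * (1 + u)]. *)
Lemma dslot_cost_quasiconvex (R : realType) (c al : R) :
  0 <= c -> 0 < al <= 1 -> pos_quasiconvex (dslot_cost c al).
Proof.
move=> c0 al01 x y z x0 xy yz.
have k0 : 0 <= c * al * ln 2.
  by case/andP: al01 => al0 _; rewrite !mulr_ge0 ?(ltW al0) ?(ltW (ln2_gt0 R)).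
have E (t : R) : dslot_cost c al t = c * al * ln 2 *
    ((2 `^ t - 1) `^ (al - 1) * (1 + (2 `^ t - 1))).
  by rewrite /dslot_cost; ring.
have mono (s t : R) : s < t -> 2 `^ s - 1 < 2 `^ t - 1.
  by move=> st; rewrite ltrD2r !pow2E ltr_expR ltr_pM2r ?ln2_gt0.
rewrite !E.
have [h|h] := @powR_mul1D_quasiconvex R al _ _ _ al01 (pow2B1_gt0 _ _ x0)
  (mono _ _ xy) (mono _ _ yz); [left | right]; exact: ler_wpM2l.
Qed.

(** * Chords and tangents around a minimizer of [f x / x] *)

(** Cross-multiplied form of [f r / r <= f x / x]. *)
Definition minimizes_ratio {R : realType} (f : R -> R) (r : R) : Prop :=
  forall x, 0 < x -> f r * x <= f x * r.

(* Otherwise the slope of [f] would be below, then above, then again below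
   [f M / M] on [(0, x)], [(x, M)] and [(M, r)]. *)
Lemma quasiconvex_chord (R : realType) (f df : R -> R) (M r x : R) :
  pos_derivative f df -> pos_quasiconvex df ->
  (forall t, 0 <= f t) -> minimizes_ratio f r -> M < r ->
  0 < x -> x <= M -> f M * x <= f x * M.
Proof.
move=> fdf qc f0 rmin Mr x0 xM.
rewrite leNgt; apply/negP => lt_ratio.
have {}xM : x < M.
  by rewrite lt_neqAle xM andbT; apply/eqP => E; rewrite E ltxx in lt_ratio.
have M0 : 0 < M by apply: lt_trans xM.
have r0 : 0 < r by apply: lt_trans Mr.
have [m fM] : exists m, f M = m * M by exists (f M / M); rewrite divfK ?gt_eqF.
have fx : f x < m * x by rewrite fM mulrAC ltr_pM2r in lt_ratio.
have fr : f r < m * r.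
  rewrite -(ltr_pM2r x0); apply: le_lt_trans (rmin x x0) _.
  by rewrite mulrAC ltr_pM2r.
have m0 : 0 < m by rewrite -(pmulr_lgt0 _ x0); exact: le_lt_trans (f0 x) fx.
have [q fq] : exists q, f x = m * q.
  by exists (f x / m); rewrite mulrC divfK ?gt_eqF.
have qx : q < x by rewrite fq ltr_pM2l in fx.
have q0 : 0 <= q by rewrite -(pmulr_rge0 _ m0) -fq.
(* No derivative is available at 0, so the interval starts at [(x - q) / 2 > 0]. As [f] is
   nonnegative, it increases there by at most [f x = m * q], which is less than [m] times the length
   [(x + q) / 2]. *)
have [||z0 /andP[z00 z0x] E0] := pos_derivative_MVT _ f df ((x - q) / 2) x fdf.
- lra.
- lra.
have [z1 /andP[z1x z1M] E1] := pos_derivative_MVT _ f df x M fdf x0 xM.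
have [z2 /andP[z2M z2r] E2] := pos_derivative_MVT _ f df M r fdf M0 Mr.
have d0 : df z0 < m.
  have h : 0 < x - (x - q) / 2 by lra.
  rewrite -(ltr_pM2r h) -E0; apply: (@le_lt_trans _ _ (f x)).
    by rewrite gerBl.
  by rewrite fq ltr_pM2l //; lra.
have d1 : m < df z1.
  have h : 0 < M - x by lra.
  by rewrite -(ltr_pM2r h) -E1 fM; lra.
have d2 : df z2 < m.
  have h : 0 < r - M by lra.
  by rewrite -(ltr_pM2r h) -E2 fM; lra.
have {}z00 : 0 < z0 by lra.
have z01 := lt_trans z0x z1x; have z12 := lt_trans z1M z2M.
by have [h|h] := qc z0 z1 z2 z00 z01 z12; lra.
Qed.

(** With [m = f r / r], the function [f t - m * t] is nonnegative for [t > 0] and vanishes at [r],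
    so its derivative vanishes there. *)
Lemma minimizes_ratio_derivative (R : realType) (f df : R -> R) (r : R) :
  pos_derivative f df -> 0 < r -> minimizes_ratio f r -> f r = df r * r.
Proof.
move=> fdf r0 rmin.
have [m fr] : exists m, f r = m * r by exists (f r / r); rewrite divfK ?gt_eqF.
pose g t := f t - m * t.
have dg (t : R) : 0 < t -> is_derive t 1 g (df t - m).
  move=> t0; have d1 := fdf t t0.
  have d2 : is_derive t 1 ( *%R m) m.
    by have := is_deriveZ m (is_derive_id t 1); rewrite scaler1.
  exact: is_deriveB.
have [|t|||_ E] := @derive1_at_min R g 0 (r + r) r.
- lra.
- by rewrite in_itv /= => /andP[t0 _]; have [] := dg t t0.
- by rewrite in_itv /=; apply/andP; split; lra.
- move=> t; rewrite in_itv /= => /andP[t0 _].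
  rewrite /g fr subrr subr_ge0 -(ler_pM2r r0) mulrAC -fr.
  exact: rmin.
have [_ E'] := dg r r0.
by rewrite E in E'; rewrite fr; congr (_ * _); lra.
Qed.

(* If the slope of [f] decreased somewhere after the minimizer [r], then by
   quasi-convexity it would have decreased all the way from [r] to [z]; so [z]
   would be a second minimizer, with slope less than [f r / r]. *)
Lemma quasiconvex_derivative_nondecreasing (R : realType) (f df : R -> R)
    (r y z : R) :
  pos_derivative f df -> pos_quasiconvex df -> 0 < r -> minimizes_ratio f r ->
  r <= y -> y <= z -> df y <= df z.
Proof.
move=> fdf qc r0 rmin ry; rewrite le_eqVlt => /predU1P[->//|yz].
rewrite leNgt; apply/negP => zy.
have Er := minimizes_ratio_derivative R f df r fdf r0 rmin.
have y0 : 0 < y by apply: lt_le_trans ry.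
have z0 : 0 < z by apply: lt_trans yz.
have before w : 0 < w -> w < y -> df y <= df w.
  move=> w0 wy; have [//|h] := qc w y z w0 wy yz.
  by have := lt_le_trans zy h; rewrite ltxx.
have dy : df y <= df r.
  by move: ry; rewrite le_eqVlt => /predU1P[->//|]; exact: before.
have dw w : r < w -> w < z -> df w <= df r.
  move=> rw wz; have w0 : 0 < w by apply: lt_trans rw.
  have [wy|yw|->//] := ltgtP w y.
  - by have [//|h] := qc r w y r0 rw wy; apply: le_trans h dy.
  - have [h|h] := qc y w z y0 yw wz; first exact: le_trans h dy.
    exact: le_trans h (le_trans (ltW zy) dy).
have rz : r < z by apply: le_lt_trans yz.
have [w /andP[rw wz] E] := pos_derivative_MVT _ f df r z fdf r0 rz.
have fz : f z <= df r * z.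
  have h : 0 <= z - r by lra.
  by have := ler_wpM2r h (dw w rw wz); rewrite -E Er; lra.
have zmin : minimizes_ratio f z.
  move=> t t0; rewrite -(ler_pM2r r0).
  apply: (@le_trans _ _ (df r * z * t * r)).
    by rewrite ler_pM2r // ler_pM2r.
  have -> : df r * z * t * r = f r * t * z by rewrite Er; ring.
  by rewrite [leRHS]mulrAC ler_pM2r //; exact: rmin.
have Ez := minimizes_ratio_derivative R f df z fdf z0 zmin.
have := rmin z z0; rewrite Er Ez mulrAC ler_pM2r // ler_pM2r // => h.
by have := le_lt_trans (le_trans dy h) zy; rewrite ltxx.
Qed.

(** Beyond [r] the derivative is nondecreasing, which puts the tangent at [p] below [f] on that
    side. Before [r], the tangent is at most 0 at the origin and at most [f r] at [r], hence below
    the ray through [(r, f r)], which is below [f] by minimality. *)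
Lemma quasiconvex_tangent (R : realType) (f df : R -> R) (r p : R) :
  pos_derivative f df -> pos_quasiconvex df ->
  (forall t, 0 <= f t) -> 0 < r -> minimizes_ratio f r -> r <= p ->
  f p <= df p * p /\ forall x, 0 <= x -> f p + df p * (x - p) <= f x.
Proof.
move=> fdf qc f0 r0 rmin rp.
have Er := minimizes_ratio_derivative R f df r fdf r0 rmin.
have mono := quasiconvex_derivative_nondecreasing R f df r _ _ fdf qc r0 rmin.
have p0 : 0 < p by apply: lt_le_trans rp.
have drp : df r <= df p by apply: mono.
have after x : r <= x -> f p + df p * (x - p) <= f x.
  move=> rx; have x0 : 0 < x by apply: lt_le_trans rx.
  have [xp|px|->] := ltgtP x p; last by rewrite subrr mulr0 addr0.
  - have [z /andP[xz zp] E] := pos_derivative_MVT _ f df x p fdf x0 xp.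
    have dzp : df z <= df p.
      by apply: mono; [exact: le_trans rx (ltW xz) | exact: ltW].
    have h : 0 <= p - x by lra.
    by have := ler_wpM2r h dzp; rewrite -E; lra.
  - have [z /andP[pz zx] E] := pos_derivative_MVT _ f df p x fdf p0 px.
    have dpz : df p <= df z by apply: mono => //; exact: ltW.
    have h : 0 <= x - p by lra.
    by have := ler_wpM2r h dpz; rewrite -E; lra.
have b0 : f p <= df p * p.
  have h1 := after r (lexx r); have h2 := ler_wpM2r (ltW r0) drp.
  by rewrite -Er in h2; lra.
split=> // x x0; have [/after//|xr] := leP r x.
have h1 := after r (lexx r).
have h2 : f r * x <= f x * r.
  move: x0; rewrite le_eqVlt => /predU1P[<-|]; last exact: rmin.
  by rewrite mulr0 mulr_ge0 ?(ltW r0).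
rewrite -(ler_pM2r r0); apply: le_trans h2.
have h3 := ler_wpM2r x0 h1.
have h4 : (f p - df p * p) * (r - x) <= 0.
  by rewrite mulr_le0_ge0 ?subr_le0 ?subr_ge0 // ltW.
lra.
Qed.

(** * Supporting line and local growth of the slot cost *)

(** Serves the case [P0 = Pss], [alpha = 1], where [R_a = 0] is a convention and not a minimizer;
    the cost is then a convex exponential. *)
Lemma slot_cost_tangent1 (R : realType) (c R0 : R) : 0 <= c -> 0 <= R0 ->
  let d := c * (2 `^ R0 * ln 2) in
  slot_cost 0 c 1 R0 <= d * R0 /\
  forall x, 0 <= x -> slot_cost 0 c 1 R0 + d * (x - R0) <= slot_cost 0 c 1 x.
Proof.
move=> c0 R00 d.
have tangent (x : R) : 2 `^ R0 * (1 + (x - R0) * ln 2) <= 2 `^ x.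
  have -> : 2 `^ x = 2 `^ R0 * expR ((x - R0) * ln 2).
    by rewrite !pow2E -expRD; congr expR; ring.
  by rewrite ler_wpM2l ?powR_ge0 // expR_ge1Dx.
have E (x : R) : 0 <= x -> slot_cost 0 c 1 x = c * (2 `^ x - 1).
  by move=> x0; rewrite /slot_cost add0r powRr1 // pow2B1_ge0.
have line (x : R) : c * (2 `^ R0 - 1) + d * (x - R0) <= c * (2 `^ x - 1).
  by have := ler_wpM2l c0 (tangent x); rewrite /d; lra.
split=> [|x x0]; last by rewrite !E //; exact: line.
by rewrite E //; have := line 0; rewrite powRr0; lra.
Qed.

(* The rate per active slot that mode [s] asymptotically aims at is
   [Num.max R0 (Num.min r Rm)]: active slots below [R0] would not fit in the
   frame. *)
Lemma slot_cost_support (R : realType) (P0 Pss gamma alpha sigma2 r R0 Rm : R) :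
  Pss <= P0 -> 0 < gamma -> 0 < sigma2 -> 0 < alpha <= 1 ->
  is_Ra P0 Pss gamma alpha sigma2 r -> 0 < R0 <= Rm ->
  let F := slot_cost (P0 - Pss) (gamma * sigma2 `^ alpha) alpha in
  let M := Num.max R0 (Num.min r Rm) in
  exists m b, [/\ b <= 0, m * R0 + b = R0 * F M / M &
    forall x, 0 <= x <= Rm -> m * x + b <= F x].
Proof.
move=> PP g0 s0 al01 Ra /andP[R00 RRm].
set c := gamma * sigma2 `^ alpha; set a := P0 - Pss => F M.
have a0 : 0 <= a by rewrite subr_ge0.
have c0 : 0 <= c by rewrite mulr_ge0 ?powR_ge0 // ltW.
have Rm0 : 0 < Rm by apply: lt_le_trans RRm.
have M0 : 0 < M by rewrite lt_max R00.
have F0 t : 0 <= F t by apply: slot_cost_ge0.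
have Fd : pos_derivative F (dslot_cost c alpha) by apply: slot_cost_derivative.
have qc := dslot_cost_quasiconvex R c alpha c0 al01.
have tangent_case d : M = R0 -> F R0 <= d * R0 /\
    (forall x, 0 <= x -> F R0 + d * (x - R0) <= F x) -> exists m b,
    [/\ b <= 0, m * R0 + b = R0 * F M / M &
    forall x, 0 <= x <= Rm -> m * x + b <= F x].
  move=> -> [b0 tg]; exists d, (F R0 - d * R0); split.
  - by rewrite subr_le0.
  - by rewrite mulrAC mulfV ?gt_eqF // mul1r; ring.
  - by move=> x /andP[x0 _]; rewrite addrCA -mulrBr; exact: tg.
move: Ra; rewrite /is_Ra; case: ifP => [/andP[/eqP EP /eqP E1] r0|_ [r0 rmin]].
  have ME : M = R0 by rewrite /M r0; apply/max_idPl; rewrite ge_min ltW.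
  apply: tangent_case ME _; rewrite /F /a EP subrr E1; exact/slot_cost_tangent1/ltW.
have {}rmin : minimizes_ratio F r.
  move=> x x0; have := rmin x x0; rewrite /ra_obj -/a -/c.
  by rewrite ler_pdivlMr // mulrAC ler_pdivrMr.
have [rR|Rr] := ltP r R0.
  have ME : M = R0 by apply/max_idPl; rewrite ge_min ltW.
  exact: tangent_case ME (quasiconvex_tangent _ _ _ _ _ Fd qc F0 r0 rmin (ltW rR)).
have ME : M = Num.min r Rm by apply/max_idPr; rewrite le_min Rr.
(* The line is the ray from the origin through [(M, F M)]. It lies below [F] by minimality if
   [M = r], and by [quasiconvex_chord] if [M = Rm < r]. *)
exists (F M / M), 0; split=> [//|//|x /andP[x0 xRm]].
  by rewrite addr0 mulrC mulrA.
rewrite addr0 mulrAC ler_pdivrMr //.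
move: x0; rewrite le_eqVlt => /predU1P[<-|x0].
  by rewrite mulr0; exact: mulr_ge0 (F0 0) (ltW M0).
have [rRm|Rmr] := leP r Rm.
  by rewrite ME (min_idPl rRm); exact: rmin.
rewrite ME (min_idPr (ltW Rmr)).
exact: quasiconvex_chord Fd qc F0 rmin Rmr x0 xRm.
Qed.

(** On [[0, 1]], [2 ^ d - 1 <= 2 * ln 2 * d], so [2 ^ (M + d) - 1] is at most [1 + q * d] times its
    value at [d = 0]; a power [al <= 1] does not enlarge a factor that is at least 1. This controls
    rates pushed above [M] by rounding. *)
Lemma slot_cost_growth (R : realType) (a c al M : R) :
  0 <= a -> 0 <= c -> 0 < al <= 1 -> 0 < M ->
  exists2 q, 0 <= q & forall d, 0 <= d <= 1 ->
    slot_cost a c al (M + d) <= slot_cost a c al M * (1 + q * d).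
Proof.
move=> a0 c0 /andP[al0 al1] M0; have u0 := pow2B1_gt0 _ _ M0.
have l0 := ltW (ln2_gt0 R).
pose q := 2 `^ M * (2 * ln 2) / (2 `^ M - 1).
have q0 : 0 <= q by rewrite divr_ge0 ?(ltW u0) // !mulr_ge0 // powR_ge0.
exists q => // d /andP[d0 d1].
have qd0 : 0 <= q * d by apply: mulr_ge0.
have h1 : 2 `^ d - 1 <= 2 * ln 2 * d.
  have h : (2 : R) `^ d <= 2 by have := ler_pow2 _ _ _ d1; rewrite powRr1.
  have e : 2 `^ d * expR (- (d * ln 2)) = 1.
    by rewrite pow2E -expRD subrr expR0.
  have := ler_wpM2l (powR_ge0 2 d) (expR_ge1Dx (- (d * ln 2))).
  rewrite e; have := ler_wpM2r (mulr_ge0 d0 l0) h; lra.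
have h2 : 2 `^ (M + d) - 1 <= (2 `^ M - 1) * (1 + q * d).
  have -> : (2 `^ M - 1) * (1 + q * d) =
      2 `^ M - 1 + 2 `^ M * (2 * ln 2 * d).
    by rewrite /q; field; rewrite gt_eqF.
  have -> : 2 `^ (M + d) = 2 `^ M * 2 `^ d.
    by rewrite !pow2E -expRD mulrDl.
  have := ler_wpM2l (powR_ge0 2 M) h1; lra.
have h3 : (2 `^ (M + d) - 1) `^ al <= (2 `^ M - 1) `^ al * (1 + q * d).
  apply: (@le_trans _ _ (((2 `^ M - 1) * (1 + q * d)) `^ al)).
    rewrite ge0_ler_powR ?(ltW al0) // nnegrE; last first.
      by apply: mulr_ge0; [exact: ltW | lra].
    by apply: pow2B1_ge0; lra.
  rewrite powRM ?(ltW u0) ?ler_wpM2l ?powR_ge0 //; last by lra.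
  have h : 1 <= 1 + q * d by lra.
  rewrite -[leRHS]powRr1 ?ler_powR //; lra.
rewrite /slot_cost mulrDl lerD //; first by rewrite ler_peMr // lerDl.
by rewrite -mulrA ler_wpM2l.
Qed.

(** * Energy spent asleep *)

Lemma Esleep_le (R : realType) (S : nat) (Ts Ps : nat -> R) (t : R) :
  (forall s, (s <= S)%N -> 0 <= Ps s) -> 0 <= Ts S -> 0 <= t ->
  Esleep S Ts Ps t <=
    Ps S * t + \sum_(s < S) Ps s * Num.max 0 (Ts s.+1 - Ts s).
Proof.
move=> Ps0 TS0 t0; rewrite /Esleep addrC lerD //.
  by rewrite ler_wpM2l ?Ps0 // ge_max t0 gerBl.
apply: ler_sum => s _; rewrite ler_wpM2l ?Ps0 ?(ltnW (ltn_ord s)) //.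
by rewrite ge_max le_max lexx /= le_max lerD2r ge_min lexx !orbT.
Qed.

Lemma Esleep_ge (R : realType) (S : nat) (Ts Ps : nat -> R) (t : R) :
  (forall s, (s <= S)%N -> 0 <= Ps s) ->
  Ps S * t - Ps S * Ts S <= Esleep S Ts Ps t.
Proof.
move=> Ps0; rewrite /Esleep -mulrBr ler_wpDl //.
  apply: sumr_ge0 => s _; rewrite mulr_ge0 ?Ps0 ?(ltnW (ltn_ord s)) //.
  by rewrite le_max lexx.
by rewrite ler_wpM2l ?Ps0 // le_max lexx orbT.
Qed.

(* Up to [O(1/N)], sleeping during [N - n] slots costs as if the deepest mode
   were available without delay. *)
Lemma sleep_share (R : realType) (T : R) (S : nat) (Ts Ps : nat -> R) :
  0 < T -> (forall s, (s <= S)%N -> 0 <= Ps s) -> 0 <= Ts S ->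
  exists2 K, 0 <= K & forall N n : nat, (0 < N)%N -> (n <= N)%N ->
    `| n%:R / N%:R * Ps S + Esleep S Ts Ps ((N - n)%:R * T) / (N%:R * T)
       - Ps S | <= K / N%:R.
Proof.
move=> T0 Ps0 TS0.
set K2 := \sum_(s < S) Ps s * Num.max 0 (Ts s.+1 - Ts s).
have K20 : 0 <= K2.
  apply: sumr_ge0 => s _; rewrite mulr_ge0 ?Ps0 ?(ltnW (ltn_ord s)) //.
  by rewrite le_max lexx.
have K10 : 0 <= Ps S * Ts S by rewrite mulr_ge0 ?Ps0.
exists ((Ps S * Ts S + K2) / T) => [|N n N0 nN].
  by rewrite divr_ge0 ?(ltW T0) // addr_ge0.
have N0' : 0 < N%:R :> R by rewrite ltr0n.
set t := (N - n)%:R * T.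
have t0 : 0 <= t by rewrite mulr_ge0 ?ler0n // ltW.
have lo := @Esleep_ge R S Ts Ps t Ps0.
have up := @Esleep_le R S Ts Ps t Ps0 TS0 t0.
rewrite -/K2 in up; move: (Esleep S Ts Ps t) lo up => E lo up.
have -> : n%:R / N%:R * Ps S + E / (N%:R * T) - Ps S =
    (E - Ps S * t) / T / N%:R.
  by rewrite /t natrB //; field; rewrite !gt_eqF.
rewrite normrM [`|N%:R^-1|]ger0_norm ?invr_ge0 ?ler0n //.
rewrite ler_wpM2r ?invr_ge0 ?ler0n // normrM.
rewrite [`|T^-1|]ger0_norm ?invr_ge0 ?(ltW T0) //.
rewrite ler_pM2r ?invr_gt0 // ler_norml; apply/andP; split; lra.
Qed.

(** * Rates, powers and the prescribed slot numbers *)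

Lemma pow2_log2 (R : realType) (y : R) : 0 < y -> 2 `^ (log2 y) = y.
Proof. by move=> y0; rewrite pow2E /log2 divfK ?gt_eqF ?ln2_gt0 ?lnK. Qed.

Lemma log2_pow2 (R : realType) (x : R) : log2 (2 `^ x) = x.
Proof. by rewrite pow2E /log2 expRK mulfK // gt_eqF ?ln2_gt0. Qed.

Lemma ler_log2 (R : realType) (x y : R) : 0 < x -> x <= y -> log2 x <= log2 y.
Proof.
move=> x0 xy; rewrite /log2 ler_pM2r ?invr_gt0 ?ln2_gt0 // ler_ln //.
exact: lt_le_trans xy.
Qed.

Lemma power_slot_cost (R : realType) (a gamma alpha sigma2 p : R) :
  0 < sigma2 -> 0 <= p ->
  slot_cost a (gamma * sigma2 `^ alpha) alpha (log2 (1 + p / sigma2)) =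
  a + gamma * p `^ alpha.
Proof.
move=> s0 p0; have q0 : 0 <= p / sigma2 by rewrite divr_ge0 // ltW.
rewrite /slot_cost pow2_log2 ?ltr_wpDr // [1 + _]addrC addrK -mulrA.
by rewrite -powRM ?(ltW s0) // [sigma2 * _]mulrC divfK ?gt_eqF.
Qed.

(** Cost of spreading the rate evenly over [n] slots; [Pcons_s] unfolds to this with [n] given by
    [Nas]. *)
Definition frame_cost {R : realType} (T P0 c alpha : R) (S : nat)
    (Ts Ps : nat -> R) (rate : R) (N n : nat) : R :=
  n%:R / N%:R * slot_cost P0 c alpha (rate * N%:R / n%:R)
  + Esleep S Ts Ps ((N - n)%:R * T) / (N%:R * T).

Lemma round_itv (R : realType) (x : R) : 0 <= x ->
  x - 1 <= (round x)%:R <= x + 1.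
Proof.
move=> x0; have x2 : 0 <= x + 2^-1 by lra.
have /andP[h1 h2] := truncn_itv x2; rewrite -[ltRHS]natr1 in h2.
by rewrite /round; apply/andP; split; lra.
Qed.

Lemma round_le_nat (R : realType) (x : R) (n : nat) :
  x <= n%:R -> (round x <= n)%N.
Proof. by move=> xn; rewrite /round truncn_le_nat -[ltRHS]natr1; lra. Qed.

(** Since [N * rate / M] is the minimum of [N * rate / Rtil] and [N], the cap [Nplus] lowers it by
    at most the delay of mode [s], and rounding moves it by at most 1. In a feasible mode both terms
    of the minimum are at least [N * rate / Rmax]. *)
Lemma Nas_itv (R : realType) (N : nat) (T sigma2 Pmax rate : R)
    (Ts Ra : nat -> R) (s : nat) :
  0 < T -> 0 <= Ts s -> 0 <= Ra s -> 0 < rate <= Rmax sigma2 Pmax ->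
  let M := Num.max rate (Rtil sigma2 Pmax Ra s) in
  let n := Nas N T sigma2 Pmax rate Ts Ra s in
  [/\ (n <= N)%N,
      N%:R * rate / M - ((Num.truncn (Ts s / T))%:R + 1) <= n%:R,
      n%:R <= N%:R * rate / M + 1 &
      inSR N T sigma2 Pmax rate Ts s ->
        N%:R * rate / Rmax sigma2 Pmax <= n%:R + 1].
Proof.
move=> T0 Ts0 Ra0 /andP[r0 rRm]; have Rm0 := lt_le_trans r0 rRm.
set Rt := Rtil _ _ _ _; set Rm := Rmax _ _ in rRm Rm0 *.
move=> M n; rewrite {}/n /Nas /inSR -/Rt -/Rm.
set k := Num.truncn _; set P := Nplus _ _ _ _.
have Rt0 : 0 <= Rt by rewrite le_min Ra0 ltW.
have RtRm : Rt <= Rm by rewrite ge_min lexx orbT.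
have M0 : 0 < M by rewrite lt_max r0.
have PN : P%:R <= N%:R :> R by rewrite ler_nat leq_subr.
have NP : N%:R - k%:R <= P%:R :> R.
  by rewrite lerBlDr -natrD ler_nat addnC -leq_subLR.
have Nr0 : 0 <= N%:R * rate by rewrite mulr_ge0 ?ler0n // ltW.
have NrM : N%:R * rate / M <= N%:R.
  by rewrite ler_pdivrMr // ler_wpM2l ?ler0n // le_max lexx.
have k0 : 0 <= k%:R :> R by rewrite ler0n.
(* Here the slot number is [Nplus] itself, [M = rate] and [N * rate / M = N]. *)
have [Rt00|Rtn0] := eqVneq Rt 0.
  have ME : M = rate by rewrite /M Rt00; apply/max_idPl/ltW.
  split.
  - exact: leq_subr.
  - by lra.
  - by rewrite ME mulfK ?gt_eqF //; lra.
  - by lra.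
have {Rtn0}Rt0 : 0 < Rt by rewrite lt_def Rtn0.
set t := Num.min _ _.
have t0 : 0 <= t by rewrite le_min ler0n divr_ge0 // ltW.
have /andP[lo up] := @round_itv R t t0.
have tP : t <= P%:R by rewrite ge_min lexx orbT.
have tlo : N%:R * rate / M - k%:R <= t.
  rewrite le_min; apply/andP; split; last by lra.
  have : N%:R * rate / M <= N%:R * rate / Rt.
    by rewrite ler_wpM2l // lef_pV2 ?posrE // le_max lexx orbT.
  by lra.
have tup : t <= N%:R * rate / M.
  rewrite /M; case: (leP rate Rt) => h; first by rewrite ge_min lexx.
  by rewrite mulfK ?gt_eqF //; lra.
split.
- by apply: round_le_nat; lra.
- by lra.
- by lra.
- move=> hP; have : N%:R * rate / Rm <= t; last by lra.
  rewrite le_min hP andbT ler_wpM2l // lef_pV2 //.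
Qed.

(** * Lower and upper bounds for uniform allocations *)

(** Rounding down can push the rate per slot above [Rm], where the allocation is infeasible and the
    line gives no bound. Monotonicity then leaves at least [F Rm] per slot, and the missing slot
    accounts for the loss [F Rm / N]. *)
Lemma uniform_share_ge (R : realType) (F : R -> R) (rate Rm m b : R)
    (N n : nat) :
  0 < rate <= Rm -> {in Num.nneg &, {homo F : x y / x <= y}} -> 0 <= F Rm ->
  b <= 0 -> (forall x, 0 <= x <= Rm -> m * x + b <= F x) ->
  (0 < n)%N -> (n <= N)%N -> N%:R * rate / Rm <= n%:R + 1 ->
  m * rate + b - F Rm / N%:R <= n%:R / N%:R * F (rate * N%:R / n%:R).
Proof.
move=> /andP[r0 rRm] mono F0 b0 line n0 nN Nn.
have Rm0 : 0 < Rm by apply: lt_le_trans rRm.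
have n0' : 0 < n%:R :> R by rewrite ltr0n.
have nN' : n%:R <= N%:R :> R by rewrite ler_nat.
have N0 : 0 < N%:R :> R by apply: lt_le_trans nN'.
have x0 : 0 <= rate * N%:R / n%:R by rewrite divr_ge0 ?mulr_ge0 // ltW.
move: N%:R n%:R Nn n0' nN' N0 x0 => {}N {}n Nn {}n0 {}nN N0 x0.
rewrite mulrAC ler_pdivlMr // mulrBl divfK ?gt_eqF //.
have [xRm|Rmx] := leP (rate * N / n) Rm.
  apply: (@le_trans _ _ (n * (m * (rate * N / n) + b))).
    have -> : n * (m * (rate * N / n) + b) = m * rate * N + n * b.
      by field; rewrite gt_eqF.
    have := ler_wnM2r b0 nN; lra.
  by rewrite ler_pM2l //; apply: line; rewrite x0 xRm.
apply: (@le_trans _ _ (n * F Rm)); last first.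
  by rewrite ler_pM2l // mono ?nnegrE // ltW.
have h1 := ler_wpM2r F0 Nn.
(* This compares with [N * rate / Rm] slots at rate [Rm]; their number is at most [N], and
   [b <= 0]. *)
have h2 : (m * rate + b) * N <= N * rate / Rm * F Rm.
  have h : m * Rm + b <= F Rm by apply: line; rewrite (ltW Rm0) lexx.
  have q0 : 0 <= N * rate / Rm by rewrite divr_ge0 ?mulr_ge0 // ltW.
  apply: le_trans (ler_wpM2l q0 h).
  have -> : N * rate / Rm * (m * Rm + b) = m * rate * N + N * (rate / Rm) * b.
    by field; rewrite gt_eqF.
  have h' : N * (rate / Rm) <= N * 1.
    by rewrite ler_pM2l // ler_pdivrMr // mul1r.
  have := ler_wnM2r b0 h'; lra.
lra.
Qed.

(** Up to one slot in excess adds at most [F M / N]. A shortfall of up to [k] slots raises the rate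
    to [M + d] with [n * d <= k * M], which the growth bound turns into the other error term;
    [k * M <= n] keeps [d <= 1]. *)
Lemma uniform_share_le (R : realType) (F : R -> R) (rate M q k : R)
    (N n : nat) :
  0 < rate -> 0 < M -> {in Num.nneg &, {homo F : x y / x <= y}} ->
  0 <= F M -> 0 <= q ->
  (forall d, 0 <= d <= 1 -> F (M + d) <= F M * (1 + q * d)) -> 0 <= k ->
  (0 < n)%N -> (n <= N)%N ->
  N%:R * rate / M - k <= n%:R -> n%:R <= N%:R * rate / M + 1 ->
  k * M <= n%:R ->
  n%:R / N%:R * F (rate * N%:R / n%:R) <=
    rate * F M / M + F M * (1 + q * (k * M)) / N%:R.
Proof.
move=> r0 M0 mono F0 q0 growth k0 n0 nN nlo nup kMn.
have n0' : 0 < n%:R :> R by rewrite ltr0n.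
have N0 : 0 < N%:R :> R by apply: lt_le_trans n0' _; rewrite ler_nat.
move: N%:R n%:R nlo nup kMn n0' N0 => {nN}N {}n nlo nup kMn {}n0 N0.
have x0 : 0 <= rate * N / n by rewrite divr_ge0 ?mulr_ge0 // ltW.
have kM0 : 0 <= k * M by rewrite mulr_ge0 // ltW.
rewrite mulrAC ler_pdivrMr // mulrDl [_ / N * N]divfK ?gt_eqF //.
have nF : n * F M <= rate * F M / M * N + F M.
  have -> : rate * F M / M * N + F M = (N * rate / M + 1) * F M by ring.
  exact: ler_wpM2r.
have [d [d0 nd Fx]] : exists d, [/\ 0 <= d, n * d <= k * M &
    F (rate * N / n) <= F M * (1 + q * d)].
  have [xM|Mx] := leP (rate * N / n) M.
    by exists 0; rewrite !mulr0 addr0 mulr1 lexx mono // nnegrE // ltW.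
  have nd : n * (rate * N / n - M) <= k * M.
    have -> : n * (rate * N / n - M) = (N * rate / M - n) * M.
      by field; rewrite !gt_eqF.
    by rewrite ler_pM2r //; lra.
  exists (rate * N / n - M); split=> //; first by rewrite subr_ge0 ltW.
  rewrite -[X in F X](subrKC M) growth // subr_ge0 ltW //=.
  by rewrite -(ler_pM2l n0) mulr1; apply: le_trans kMn.
apply: (le_trans (ler_wpM2l (ltW n0) Fx)).
have := ler_wpM2l (mulr_ge0 F0 q0) nd; lra.
Qed.

(** * Allocations of the problem in terms of slot costs *)

Lemma slot_costD (R : realType) (a b c al x : R) :
  slot_cost (a + b) c al x = slot_cost a c al x + b.
Proof. by rewrite /slot_cost addrAC. Qed.

Lemma frame_costE (R : realType) (T P0 c alpha : R) (S : nat)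
    (Ts Ps : nat -> R) (rate : R) (N n : nat) :
  frame_cost T P0 c alpha S Ts Ps rate N n =
    n%:R / N%:R * slot_cost (P0 - Ps S) c alpha (rate * N%:R / n%:R) +
    (n%:R / N%:R * Ps S + Esleep S Ts Ps ((N - n)%:R * T) / (N%:R * T)).
Proof.
rewrite /frame_cost addrA -mulrDr -slot_costD.
by rewrite (subrK (Ps S) P0).
Qed.

Lemma Pcons_uniform (R : realType) (N n : nat) (T sigma2 Pmax gamma alpha : R)
    (S : nat) (Ts Ps : nat -> R) (rate : R) :
  0 < sigma2 -> 0 < Pmax -> 0 < rate -> (0 < n)%N -> (n <= N)%N ->
  rate * N%:R / n%:R <= Rmax sigma2 Pmax ->
  exists2 p, feasible N sigma2 Pmax rate n p &
    Pcons N T gamma alpha S Ts Ps n p =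
    frame_cost T (Ps 0%N) (gamma * sigma2 `^ alpha) alpha S Ts Ps rate N n.
Proof.
move=> s0 Pm0 r0 n0 nN; set x := _ / _ => xRm.
have n0' : n%:R != 0 :> R by rewrite pnatr_eq0 -lt0n.
have N0' : N%:R != 0 :> R by rewrite pnatr_eq0 -lt0n (leq_trans n0).
have x0 : 0 <= x by rewrite divr_ge0 ?mulr_ge0 // ltW.
have u0 := pow2B1_ge0 _ _ x0.
pose p := sigma2 * (2 `^ x - 1).
have p0 : 0 <= p by rewrite mulr_ge0 // ltW.
have ps : 1 + p / sigma2 = 2 `^ x.
  by rewrite /p [sigma2 * _]mulrC mulfK ?gt_eqF // subrKC.
exists (fun=> p); first split=> // [i _|].
- rewrite p0 /=; have := ler_pow2 _ _ _ xRm.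
  rewrite pow2_log2 ?ltr_wpDr ?divr_ge0 ?(ltW Pm0) ?(ltW s0) //.
  by rewrite -ps lerD2l ler_pM2r ?invr_gt0.
- rewrite sumr_const card_ord ps log2_pow2 -mulr_natr /x.
  by field; rewrite n0' N0'.
- rewrite /Pcons /frame_cost sumr_const card_ord -/x; congr (_ + _).
  have := power_slot_cost R 0 gamma alpha sigma2 p s0 p0.
  rewrite ps log2_pow2 add0r -[Ps 0%N]add0r addrC slot_costD => ->.
  by rewrite -mulr_natr; ring.
Qed.

(** The line is summed over the active slots: their rates add up to [rate * N], and [b <= 0] gives
    [Na * b >= N * b]. *)
Lemma Pcons_ge (R : realType) (N Na : nat) (T sigma2 Pmax gamma alpha : R)
    (S : nat) (Ts Ps : nat -> R) (rate m b : R) (p : nat -> R) :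
  0 < sigma2 -> (0 < N)%N -> b <= 0 ->
  (forall x, 0 <= x <= Rmax sigma2 Pmax -> m * x + b <=
    slot_cost (Ps 0%N - Ps S) (gamma * sigma2 `^ alpha) alpha x) ->
  feasible N sigma2 Pmax rate Na p ->
  m * rate + b + (Na%:R / N%:R * Ps S +
    Esleep S Ts Ps ((N - Na)%:R * T) / (N%:R * T))
  <= Pcons N T gamma alpha S Ts Ps Na p.
Proof.
move=> s0 N0 b0 line [NaN pP rateE].
have N0' : 0 < N%:R :> R by rewrite ltr0n.
set F := slot_cost _ _ _ in line.
pose x (i : 'I_Na) := log2 (1 + p i / sigma2).
have p0 (i : 'I_Na) : 0 <= p i by case/andP: (pP i (ltn_ord i)).
have xP (i : 'I_Na) : 0 <= x i <= Rmax sigma2 Pmax.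
  have /andP[_ pPm] := pP i (ltn_ord i).
  have q0 : 0 <= p i / sigma2 by rewrite divr_ge0 // ltW.
  rewrite !ler_log2 ?ltr_wpDr //; last by rewrite lerD2l ler_pM2r ?invr_gt0.
  by rewrite andbT -(log2_pow2 _ 0) powRr0 ler_log2 ?ler_wpDr.
have sumF : \sum_(i < Na) F (x i) =
    Na%:R * (Ps 0%N - Ps S) + gamma * \sum_(i < Na) p i `^ alpha.
  under eq_bigr do rewrite /F power_slot_cost //.
  by rewrite big_split /= sumr_const card_ord -[in LHS]mulr_natl mulr_sumr.
have -> : Pcons N T gamma alpha S Ts Ps Na p = (\sum_(i < Na) F (x i)) / N%:R +
    (Na%:R / N%:R * Ps S + Esleep S Ts Ps ((N - Na)%:R * T) / (N%:R * T)).
  by rewrite /Pcons sumF addrA; congr (_ + _); ring.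
rewrite lerD2r ler_pdivlMr //.
have sumx : \sum_(i < Na) x i = rate * N%:R.
  by rewrite -rateE mulrAC mul1r mulVf ?mul1r ?gt_eqF.
apply: (@le_trans _ _ (\sum_(i < Na) (m * x i + b))); last first.
  by apply: ler_sum => i _; exact: line.
rewrite big_split /= -mulr_sumr sumx sumr_const card_ord -[b *+ _]mulr_natr.
by rewrite mulrDl mulrA lerD2l ler_wnM2l // ler_nat.
Qed.

(** * Signs of the data and the asymptotic comparison *)

Lemma nondecreasing_start_ge0 (R : realType) (S : nat) (Ts : nat -> R) :
  Ts 0%N = 0 -> ((0 < S)%N -> Ts 0%N <= Ts 1%N) ->
  (forall s : nat, (1 <= s)%N -> (s < S)%N -> Ts s < Ts s.+1) ->
  forall s, (s <= S)%N -> 0 <= Ts s.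
Proof.
move=> T00 T01 Tlt; elim=> [|[|s] IH] sS; first by rewrite T00.
- by rewrite -T00; exact: T01.
- exact: le_trans (IH (ltnW sS)) (ltW (Tlt _ _ sS)).
Qed.

Lemma nonincreasing_power_ge (R : realType) (S : nat) (Ps : nat -> R) :
  (forall s : nat, (s < S)%N -> Ps s.+1 <= Ps s) ->
  forall s, (s <= S)%N -> Ps S <= Ps s.
Proof.
move=> Pdec s sS; rewrite -(subnK sS).
move: (S - s)%N (subnK sS) => d; elim: d s {sS} => [//|d IH] s E.
rewrite addSnnS; apply: (le_trans (IH s.+1 _)); first by rewrite -addSnnS.
by apply: Pdec; rewrite -E addSn ltnS leq_addl.
Qed.

Lemma is_Ra_ge0 (R : realType) (P0 Pss gamma alpha sigma2 r : R) :
  is_Ra P0 Pss gamma alpha sigma2 r -> 0 <= r.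
Proof. by rewrite /is_Ra; case: ifP => _; [move=> -> | case=> /ltW]. Qed.

Theorem theorem2 (R : realType) (T sigma2 Pmax alpha gamma : R) (S : nat)
    (Ts Ps Ra : nat -> R) (rate : R) :
  0 < T -> 0 < sigma2 -> 0 < Pmax -> 0 < alpha <= 1 -> 0 < gamma ->
  0 <= Ps 0%N ->
  Ts 0%N = 0 -> ((0 < S)%N -> Ts 0%N <= Ts 1%N) ->
  (forall s : nat, (1 <= s)%N -> (s < S)%N -> Ts s < Ts s.+1) ->
  (forall s : nat, (s < S)%N -> Ps s.+1 <= Ps s) -> 0 <= Ps S ->
  (forall s : nat, (s <= S)%N -> is_Ra (Ps 0%N) (Ps s) gamma alpha sigma2 (Ra s)) ->
  0 < rate <= Rmax sigma2 Pmax ->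
  exists (C : R) (N0 : nat), forall N : nat, (N0 <= N)%N ->
    `| Pstar N T sigma2 Pmax gamma alpha S Ts Ps rate
       - Pmin N T sigma2 Pmax gamma alpha S Ts Ps Ra rate | <= C / N%:R.
Proof.
move=> T0 s0 Pm0 al01 g0 _ T00 T01 Tlt Pdec PS0 HRa rr.
have Ts0 := nondecreasing_start_ge0 R S Ts T00 T01 Tlt.
have PsS := nonincreasing_power_ge R S Ps Pdec.
have Ps0 s (sS : (s <= S)%N) : 0 <= Ps s := le_trans PS0 (PsS s sS).
have Ra0 s (sS : (s <= S)%N) : 0 <= Ra s := is_Ra_ge0 _ _ _ _ _ _ _ (HRa s sS).
have [m [b [b0 mb line]]] := slot_cost_support R (Ps 0%N) (Ps S) gamma alpha
  sigma2 (Ra S) rate (Rmax sigma2 Pmax) (PsS 0%N (leq0n S)) g0 s0 al01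
  (HRa S (leqnn S)) rr.
have [K K0 share] := sleep_share R T S Ts Ps T0 Ps0 (Ts0 S (leqnn S)).
move: mb; rewrite -[Num.min (Ra S) _]/(Rtil sigma2 Pmax Ra S).
set Rm := Rmax sigma2 Pmax in rr line *.
set c := gamma * sigma2 `^ alpha in line *.
set F := slot_cost (Ps 0%N - Ps S) c alpha in line *.
set M := Num.max rate _ => mb.
have /andP[r0 rRm] := rr.
have Rm0 : 0 < Rm := lt_le_trans r0 rRm.
have rM : rate <= M by rewrite le_max lexx.
have M0 : 0 < M := lt_le_trans r0 rM.
have MRm : M <= Rm by rewrite ge_max rRm ge_min lexx orbT.
have c0 : 0 <= c by rewrite mulr_ge0 ?powR_ge0 // ltW.
have al0 : 0 <= alpha by case/andP: al01 => /ltW.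
have a0 : 0 <= Ps 0%N - Ps S by rewrite subr_ge0 PsS.
have F0 x : 0 <= F x by apply: slot_cost_ge0.
have Fmono : {in Num.nneg &, {homo F : x y / x <= y}}.
  by move=> x y; rewrite !nnegrE => x0 _; exact: ler_slot_cost.
have [q q0 growth] : exists2 q, 0 <= q & forall d, 0 <= d <= 1 ->
  F (M + d) <= F M * (1 + q * d) by apply: slot_cost_growth.
(* The common limit; by [mb] it also equals [rate * F M / M + Ps S], the form met in the upper
   bounds. *)
pose V := m * rate + b + Ps S.
pose cost N n := frame_cost T (Ps 0%N) c alpha S Ts Ps rate N n.
pose P N := Pcons N T gamma alpha S Ts Ps.
have cost_ge N n : (0 < n)%N -> (n <= N)%N ->
    N%:R * rate / Rm <= n%:R + 1 -> V - (F Rm + K) / N%:R <= cost N n.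
  move=> n0 nN Nn; rewrite /cost frame_costE /V [(_ + K) / _]mulrDl.
  have := uniform_share_ge R F rate Rm m b N n rr Fmono (F0 Rm) b0 line n0 nN Nn.
  have := share N n (leq_trans n0 nN) nN; rewrite ler_norml -/F => /andP[].
  move: (F Rm) (n%:R / N%:R * F _) (n%:R / N%:R * Ps S + _) => ? ? ?.
  by clear; lra.
have cost_le N n k : 0 <= k -> (0 < n)%N -> (n <= N)%N ->
    N%:R * rate / M - k <= n%:R -> n%:R <= N%:R * rate / M + 1 ->
    k * M <= n%:R ->
    cost N n <= V + (F M * (1 + q * (k * M)) + K) / N%:R.
  move=> k0 n0 nN nlo nup kn; rewrite /cost frame_costE /V [(_ + K) / _]mulrDl mb.
  have := uniform_share_le R F rate M q k N n r0 M0 Fmono (F0 M) q0 growth k0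
    n0 nN nlo nup kn.
  have := share N n (leq_trans n0 nN) nN; rewrite ler_norml -/F => /andP[].
  move: (F M * _) (rate * F M / M) (n%:R / N%:R * F _)
    (n%:R / N%:R * Ps S + _) => ? ? ? ?.
  by clear; lra.
have P_ge N Na p : (0 < N)%N -> feasible N sigma2 Pmax rate Na p ->
    V - K / N%:R <= P N Na p.
  move=> N0 fp; have [NaN _ _] := fp.
  have := Pcons_ge R N Na T sigma2 Pmax gamma alpha S Ts Ps rate m b p s0 N0 b0
    line fp.
  have := share N Na N0 NaN; rewrite ler_norml -/(P N) /V => /andP[].
  move: (P N Na p) (Na%:R / N%:R * Ps S + _) => ? ?.
  by clear; lra.
have Pstar_bounds N : (0 < N)%N ->
    V - K / N%:R <= Pstar N T sigma2 Pmax gamma alpha S Ts Ps rate <=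
    V + (F M + K) / N%:R.
  move=> N0; have N0' : 0 < N%:R :> R by rewrite ltr0n.
  (* Rounding up keeps the rate per slot at most [M <= Rm], so this allocation is feasible. *)
  pose n := minn N (Num.truncn (N%:R * rate / M)).+1.
  have NrM0 : 0 <= N%:R * rate / M by rewrite divr_ge0 ?mulr_ge0 // ltW.
  have NrMN : N%:R * rate / M <= N%:R by rewrite ler_pdivrMr // ler_pM2l.
  have /andP[t1 t2] := truncn_itv NrM0.
  have n0 : (0 < n)%N by rewrite leq_min N0.
  have nN : (n <= N)%N by rewrite geq_minl.
  have nlo : N%:R * rate / M <= n%:R.
    by rewrite /n /minn; case: ifP => // _; exact: ltW.
  have nup : n%:R <= N%:R * rate / M + 1.
    apply: (@le_trans _ _ (Num.truncn (N%:R * rate / M)).+1%:R).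
      by rewrite ler_nat geq_minr.
    by rewrite -[leLHS]natr1 lerD2r.
  have n0' : 0 < n%:R :> R by rewrite ltr0n.
  have xRm : rate * N%:R / n%:R <= Rm.
    apply: le_trans MRm; rewrite ler_pdivrMr // -ler_pdivrMl // mulrC.
    by rewrite [rate * _]mulrC.
  have [p fp Pp] := Pcons_uniform R N n T sigma2 Pmax gamma alpha S Ts Ps rate
    s0 Pm0 r0 n0 nN xRm.
  apply/andP; split.
    apply: lb_le_inf; first by exists (P N n p), n, p.
    by move=> _ [Na [p' [fp' ->]]]; exact: P_ge.
  apply: (@le_trans _ _ (P N n p)).
    apply: ge_inf; last by exists n, p.
    exists (V - K / N%:R) => _ [Na [p' [fp' ->]]]; exact: P_ge.
  rewrite /P Pp -/c -/(cost N n).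
  have := cost_le N n 0 (lexx 0) n0 nN; rewrite subr0 !mul0r mulr0 addr0 mulr1.
  by apply; rewrite // ler0n.
pose PS N := Pcons_s N T sigma2 Pmax gamma alpha S Ts Ps Ra rate.
(* Bound on the shortfall of [Nas] below its target: the delay of mode [s] plus one for rounding. *)
pose kk s : R := (Num.truncn (Ts s / T))%:R + 1.
have kk0 s : 0 <= kk s by rewrite addr_ge0 ?ler0n.
have PS_ge N s : (s <= S)%N -> 1 < N%:R * rate / Rm ->
    inSR N T sigma2 Pmax rate Ts s -> V - (F Rm + K) / N%:R <= PS N s.
  move=> sS N1 sR.
  have [nN _ _ /(_ sR) nlo] := Nas_itv R N T sigma2 Pmax rate Ts Ra s T0
    (Ts0 s sS) (Ra0 s sS) rr.
  (* [1 < N * rate / Rm <= n + 1] makes [n] positive. *)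
  apply: (cost_ge _ _ _ nN nlo); rewrite -(ltr0n R); rewrite -/Rm in nlo.
  by move: nlo N1; clear; lra.
have PS_le N s : (s <= S)%N -> Num.max rate (Rtil sigma2 Pmax Ra s) = M ->
    kk s + kk s * M + 1 <= N%:R * rate / M ->
    PS N s <= V + (F M * (1 + q * (kk s * M)) + K) / N%:R.
  move=> sS ME Nbig.
  have [nN nlo nup _] := Nas_itv R N T sigma2 Pmax rate Ts Ra s T0
    (Ts0 s sS) (Ra0 s sS) rr.
  rewrite ME -/(kk s) in nlo nup.
  have kM := mulr_ge0 (kk0 s) (ltW M0).
  apply: cost_le => //; first by rewrite -(ltr0n R); move: nlo Nbig kM; clear; lra.
  by move: nlo Nbig kM; clear; lra.
have inSR0 N : inSR N T sigma2 Pmax rate Ts 0.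
  rewrite /inSR /Nplus T00 mul0r truncn0 subn0 -/Rm ler_pdivrMr //.
  by rewrite ler_wpM2l ?ler0n.
(* A mode that aims at [M] and is feasible for all large [N]: mode 0 if [rate = Rm]; otherwise [S],
   whose delay fits once [N * (1 - rate / Rm)] reaches [kk S]. *)
have [s [sS ME [A sR]]] : exists s, [/\ (s <= S)%N,
    Num.max rate (Rtil sigma2 Pmax Ra s) = M &
    exists A : R, forall N, A <= N%:R -> inSR N T sigma2 Pmax rate Ts s].
  move: rRm; rewrite le_eqVlt => /predU1P[rE|rlt].
    exists 0%N; split=> //; last by exists 0.
    have -> : M = rate by apply/eqP; rewrite eq_le rM rE MRm.
    by apply/max_idPl; rewrite rE ge_min lexx orbT.
  exists S; split=> //; exists (kk S / (1 - rate / Rm)) => N.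
  have d0 : 0 < 1 - rate / Rm by rewrite subr_gt0 ltr_pdivrMr // mul1r.
  rewrite ler_pdivrMr // /inSR -/Rm => h.
  apply: (@le_trans _ _ (N%:R - kk S)); first by move: h; clear; lra.
  rewrite lerBlDr /kk natr1 -natrD ler_nat /Nplus.
  by rewrite addnS leqW // addnC -leq_subLR.
(* The three thresholds give the feasibility of [s], [1 < N * rate / Rm], and the size condition of
   [PS_le]. *)
pose B := Num.max A (Num.max (2 * Rm / rate) ((kk s + kk s * M + 1) * M / rate)).
(* Dominates both differences between an upper bound of one value and the lower bound of the
   other. *)
exists (F Rm + F M * (1 + q * (kk s * M)) + K + K), (Num.truncn B).+1 => N BN.
have {}BN : B < N%:R.
  by apply: lt_le_trans (truncnS_gt B) _; rewrite ler_nat.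
rewrite !gt_max in BN; case/and3P: BN => /ltW AN BN1 BN2.
have N1 : 1 < N%:R * rate / Rm.
  rewrite ltr_pdivlMr // mul1r -ltr_pdivrMr //; apply: le_lt_trans BN1.
  by rewrite ler_pM2r ?invr_gt0 // mulr_natl mulr2n ler_wpDl // ltW.
have N0 : (0 < N)%N.
  by case: N N1 {AN BN1 BN2} => [|//]; rewrite !mul0r ltr10.
have N2 : kk s + kk s * M + 1 <= N%:R * rate / M.
  by rewrite ler_pdivlMr // -ler_pdivrMr // ltW.
have /andP[st1 st2] := Pstar_bounds N N0.
have mi1 : V - (F Rm + K) / N%:R <=
    Pmin N T sigma2 Pmax gamma alpha S Ts Ps Ra rate.
  (* The seed of the minimum is mode 0, feasible by [inSR0]. *)
  apply: le_bigmin; first exact: PS_ge.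
  by move=> i; apply: PS_ge => //; rewrite -ltnS.
have mi2 : Pmin N T sigma2 Pmax gamma alpha S Ts Ps Ra rate <=
    V + (F M * (1 + q * (kk s * M)) + K) / N%:R.
  apply: le_trans (PS_le N s sS ME N2).
  have sS' : (s < S.+1)%N by [].
  exact: (bigmin_le_cond _ (j := Ordinal sS') _ (sR N AN)).
have i0 : 0 <= N%:R^-1 :> R by rewrite invr_ge0 ler0n.
have p1 := mulr_ge0 (F0 Rm) i0; have p2 := mulr_ge0 (F0 M) i0.
have p3 := mulr_ge0 (mulr_ge0 (F0 M) (mulr_ge0 q0 (mulr_ge0 (kk0 s) (ltW M0)))) i0.
have p4 := mulr_ge0 K0 i0.
rewrite ler_norml; apply/andP; move: st1 st2 mi1 mi2 p1 p2 p3 p4.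
move: (Pstar _ _ _ _ _ _ _ _ _ _) (Pmin _ _ _ _ _ _ _ _ _ _ _) (F M) (F Rm).
move: (N%:R^-1) (kk s * M); clearbody V; clear => ? ? ? ? ? ?.
by split; lra.
Qed.
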